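(* Let $\{g_\ell\}_{\ell\in\mathbb{N}}$ be a sequence of continuous $g$-functions on $X=A^{\mathbb{N}}$ such that each $g_\ell$ is locally constant of range $\ell+1$, and suppose $g_\ell\to g$ in the sup-norm. If \[ \lim_{\ell\to\infty}\|\log(g/g_\ell)\|\,e^{\operatorname{svar}_\ell(\log\circ g_\ell)}=0, \] then the sequence $\{\mu_\ell\}_{\ell\in\mathbb{N}}$, where $\mu_\ell$ is the unique compatible $g_\ell$-measure, converges in the projective distance $\rho$, and its limit $\mu$ is the unique compatible $g$-measure.
   Context: $A$ is a finite alphabet, $X=A^{\mathbb{N}}$ with product topology, $T$ the left shift, $\pmb{x}_n^m=x_n\cdots x_m$, $[\pmb{a}]=\{\pmb{x}:\pmb{x}_1^n=\pmb{a}\}$ for $\pmb{a}\in A^n$. $\mathcal{M}^+(X)$: Borel probability measures positive on every cylinder. Projective distance: $\rho(\mu,\nu)=\sup_{n}\max_{\pmb{a}\in A^n}\frac1n|\log(\mu[\pmb{a}]/\nu[\pmb{a}])|$. A ($g$-function) is a continuous $g:X\to(0,1)$ with $\sum_{a\in A}g(a x_2x_3\cdots)=1$ for all $\pmb{x}$. A compatible $g$-measure is a $T$-invariant $\mu\in\mathcal{M}^+(X)$ with $\lim_{n\to\infty}\mu[a_1\pmb{a}_2^n]/\mu[\pmb{a}_2^n]=g(\pmb{a})$ for all $\pmb{a}\in X$. A function $\phi$ is locally constant of range $\ell$ if $\pmb{x}_1^\ell=\pmb{y}_1^\ell$ implies $\phi(\pmb{x})=\phi(\pmb{y})$ (a $g$-function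 locally constant of range $\ell+1$ has a unique compatible $g$-measure, which is an $\ell$-step Markov measure). $\|\cdot\|$ is the sup-norm. $\operatorname{var}_k\phi=\max_{\pmb{a}\in A^k}\{\sup_{[\pmb{a}]}\phi-\inf_{[\pmb{a}]}\phi\}$ and $\operatorname{svar}_\ell\phi=\sum_{k=1}^\ell\operatorname{var}_k\phi$. *)

(* Defs.v *)
From HB Require Import structures.
From mathcomp Require Import all_boot all_order all_algebra.
From mathcomp Require Import all_classical all_reals all_analysis.
Set Implicit Arguments. Unset Strict Implicit. Unset Printing Implicit Defensive.
Import Order.TTheory GRing.Theory Num.Theory.
Import numFieldNormedType.Exports.
Local Open Scope classical_set_scope.
Local Open Scope ring_scope.

(* The one-sided full shift X = A^N over a finite nonempty alphabet A
   (a0 : A only witnesses nonemptiness).  Coordinates are 0-based: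
   x = x_0 x_1 x_2 ... *)
Definition shiftspace (A : finType) (a0 : A) := nat -> A.

Section Shift.
Variables (A : finType) (a0 : A).

HB.instance Definition _ := Choice.on (shiftspace a0).
HB.instance Definition _ := isPointed.Build (shiftspace a0) (fun _ => a0).

Definition cyl (w : seq A) : set (shiftspace a0) :=
  [set x | forall i, (i < size w)%N -> x i = nth a0 w i].

Definition cylinders : set (set (shiftspace a0)) := [set cyl w | w in setT].

End Shift.

(* X with its Borel sigma-algebra (generated by the cylinders, which form a
   base of the product topology). *)
Definition X (A : finType) (a0 : A) := g_sigma_algebraType (@cylinders A a0).

Section Defs.
Variables (A : finType) (a0 : A) (R : realType).
Local Notation X := (X a0).
Local Notation cyl := (@cyl A a0).

Definition shift (x : X) : X := fun i => x i.+1.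

Definition prefix (x : X) (n : nat) : seq A := mkseq x n.

Definition prod_continuous (f : X -> R) : Prop :=
  forall (x : X) (eps : R), 0 < eps -> exists n : nat, forall y : X,
    (forall i, (i < n)%N -> y i = x i) -> `|f y - f x| < eps.

Definition gfunction (g : X -> R) : Prop :=
  prod_continuous g /\ (forall x, 0 < g x < 1) /\
  (forall x : X, \sum_(a : A) g (fun i => if i is j.+1 then x j.+1 else a) = 1).

Definition loc_const (l : nat) (f : X -> R) : Prop :=
  forall x y : X, (forall i, (i < l)%N -> x i = y i) -> f x = f y.

Definition supnorm (f : X -> R) : R := sup (range (fun x => `|f x|)).

Definition var (k : nat) (f : X -> R) : R :=
  \big[Num.max/0]_(w : k.-tuple A)
     (sup (f @` cyl (val w)) - inf (f @` cyl (val w))).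

Definition svar (l : nat) (f : X -> R) : R := \sum_(1 <= k < l.+1) var k f.

Definition mcyl (mu : probability X R) (w : seq A) : R := fine (mu (cyl w)).

Definition compatible (g : X -> R) (mu : probability X R) : Prop :=
  (forall w, (0 < mu (cyl w))%E) /\
  (forall E : set X, measurable E -> mu (shift @^-1` E) = mu E) /\
  (forall x : X,
     (fun n : nat => mcyl mu (prefix x n.+1) / mcyl mu (prefix (shift x) n) : R)
       @ \oo --> (g x : R)).

Definition rho (mu nu : probability X R) : \bar R :=
  ereal_sup [set (((size w)%:R)^-1 * `|ln (mcyl mu w / mcyl nu w)|)%:E
            | w in [set w : seq A | (0 < size w)%N] ].

End Defs.

(* Main.v *)
Require Import Defs.
From HB Require Import structures.
From mathcomp Require Import all_boot all_order all_algebra.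
From mathcomp Require Import all_classical all_reals all_analysis.
From mathcomp Require Import lra ring.
Import Order.TTheory GRing.Theory Num.Theory.
Import numFieldNormedType.Exports.
Local Open Scope classical_set_scope.
Local Open Scope ring_scope.

(* Let G = g_l, so that the functions of the first l coordinates are stable
   under the transfer operator L f (x) = sum_a G(a x) f(a x), and let
   osc_k f be the oscillation of f over pairs of points that agree on their
   first k coordinates.  Coupling one step of the two chains started at such a
   pair gives
     osc_k (L f) <= p_{k+1} osc_{k+1} f + (1 - p_{k+1}) osc_0 f,
   with p_k = exp (- var_k (log G)).  Summing along the iterates of the
   indicator f of a cylinder [u], this yields
     sum_j osc_0 (L^j f) <= |u| exp (svar_l (log G)):
   the expected number of failures before l successes in a row.  If nu is
   compatible with h and |log (h / G)| <= d, replacing f by L f changes the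
   nu-mean by at most (e^d - 1) osc_0 f, hence
     |nu[u] - mu_l[u]| <= (e^d - 1) |u| exp (svar_l (log G)).
   The hypothesis therefore makes mu_l[u] a Cauchy sequence whose limit is the
   value on [u] of every g-measure.  This estimate is only useful for u of
   bounded length; for long u one removes the first letters one at a time:
   each ratio mu[a w] / mu[w] is, for mu = mu_l as well as for the limit,
   within e^{o(1)} of g on [a w], by uniform continuity of log g. *)

(** * Words, cylinders and infinite paths in the tree of words *)

Section Words.
Set Implicit Arguments. Unset Strict Implicit.
Variables (A : finType) (a0 : A).
Local Notation X := (X a0).
Local Notation cyl := (@cyl A a0).
Local Notation prefix := (@Defs.prefix A a0).
Local Notation shift := (@Defs.shift A a0).

Definition cons_word (a : A) (x : X) : X := fun i => if i is j.+1 then x j else a.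

Definition word_point (w : seq A) : X := fun i => nth a0 w i.

Lemma cylP (w : seq A) (x : X) : cyl w x <-> prefix x (size w) = w.
Proof.
split=> [wx|<- i]; last first.
  by rewrite size_mkseq => iw; rewrite nth_mkseq.
apply: (@eq_from_nth _ a0); first by rewrite size_mkseq.
by move=> i; rewrite size_mkseq => iw; rewrite nth_mkseq// wx.
Qed.

Lemma eq_prefix (x y : X) n :
  (forall i, (i < n)%N -> x i = y i) -> prefix x n = prefix y n.
Proof. by move=> xy; apply/eq_in_map => i; rewrite mem_iota => /xy. Qed.

Lemma cyl_prefix (x : X) n : cyl (prefix x n) x.
Proof. by apply/cylP; rewrite size_mkseq. Qed.

Lemma prefix_shift (x : X) n : prefix (shift x) n = behead (prefix x n.+1).
Proof.
by rewrite /Defs.prefix /mkseq /= -(addn0 1%N) iotaDl -map_comp; apply: eq_map.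
Qed.

Lemma cyl_rcons (w : seq A) (b : A) (x : X) :
  cyl (rcons w b) x <-> cyl w x /\ x (size w) = b.
Proof.
split=> [wx|[wx xb] i].
  split=> [i iw|].
    by rewrite wx ?size_rcons ?ltnS 1?ltnW// nth_rcons iw.
  by rewrite wx ?size_rcons// nth_rcons ltnn eqxx.
rewrite size_rcons ltnS leq_eqVlt nth_rcons => /predU1P[->|iw].
  by rewrite ltnn eqxx.
by rewrite iw wx.
Qed.

Lemma cyl_cons (a : A) (w : seq A) (x : X) :
  cyl (a :: w) x <-> x 0%N = a /\ cyl w (shift x).
Proof.
split=> [wx|[xa wx] [|i]//=]; last by rewrite ltnS => /wx.
by split=> [|i iw]; [exact: (wx 0%N)|exact: (wx i.+1)].
Qed.

(* König's lemma for the full shift. *)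
Lemma extend_path (P : seq A -> Prop) (w : seq A) :
  P w -> (forall v, P v -> exists b, P (rcons v b)) ->
  exists x : X, cyl w x /\ forall n, (size w <= n)%N -> P (prefix x n).
Proof.
move=> Pw Pext.
have /boolp.choice[next nextP] : forall v, exists b, P v -> P (rcons v b).
  move=> v; have [/Pext[b Pb]|nPv] := pselect (P v); first by exists b.
  by exists a0.
pose ws n := iter n (fun v => rcons v (next v)) w.
have Pws n : P (ws n) by elim: n => //= n; exact: nextP.
have sws n : size (ws n) = (size w + n)%N.
  by elim: n => [|n IHn]; rewrite ?addn0//= size_rcons IHn addnS.
have nthws i n k : (i < size w + n)%N ->
    nth a0 (ws (n + k)%N) i = nth a0 (ws n) i.
  move=> iwn; elim: k => [|k IHk]; first by rewrite addn0.
  rewrite addnS /= nth_rcons sws (leq_trans iwn) ?IHk//.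
  by rewrite leq_add2l leq_addr.
(* [ws i.+1] has more than [i] letters, so its letter [i] is genuine and no longer changes. *)
pose x : X := fun i => nth a0 (ws i.+1) i.
have xws n : prefix x (size w + n) = ws n.
  apply: (@eq_from_nth _ a0); rewrite size_mkseq ?sws// => i iwn.
  rewrite nth_mkseq// /x; have [ni|ni] := leqP n i.
    by rewrite -(nthws i n (i.+1 - n)%N)// subnKC// ltnW.
  by rewrite -(nthws i i.+1 (n - i.+1)%N) ?subnKC// addnS ltnS leq_addl.
exists x; split; first by apply/cylP; rewrite -[X in prefix x X]addn0 xws.
by move=> n wn; rewrite -(subnKC wn) xws.
Qed.

End Words.

(** * Cylinder weights of invariant measures and their ratios *)

Section Invariant_weights.
Set Implicit Arguments. Unset Strict Implicit.
Variables (A : finType) (a0 : A) (R : realType).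
Local Notation X := (X a0).
Local Notation cyl := (@cyl A a0).
Local Notation prefix := (@Defs.prefix A a0).
Local Notation shift := (@Defs.shift A a0).

(** The cylinder values of a fully supported shift-invariant probability: [weight_rcons] is
    additivity, [weight_cons] is invariance. In this form a limit of such values can be handled
    before it is known to come from a measure. *)
Record invariant_weight (m : seq A -> R) : Prop := InvariantWeight {
  weight_nil : m [::] = 1 ;
  weight_gt0 : forall w, 0 < m w ;
  weight_rcons : forall w, m w = \sum_(b : A) m (rcons w b) ;
  weight_cons : forall w, m w = \sum_(a : A) m (a :: w) }.

Lemma measurable_cyl (w : seq A) : measurable (cyl w : set X).
Proof. by apply: sub_sigma_algebra; exists w. Qed.

Lemma measure_letter_partition (mu : probability X R) (E : set X) (F : A -> set X) :
  (forall a, measurable (F a)) -> trivIset setT F ->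
  (forall x, E x <-> exists a, F a x) ->
  fine (mu E) = \sum_(a : A) fine (mu (F a)).
Proof.
move=> mF tF EF.
have -> : E = \bigcup_(a in setT) F a.
  by apply/seteqP; split=> [x /EF[a ?]|x [a _ ?]]; [exists a|apply/EF; exists a].
rewrite measure_fin_bigcup//; last exact: finite_finset.
have -> : [set: A] = [set` index_enum A].
  by apply/seteqP; split=> // a _ /=; rewrite mem_index_enum.
rewrite -fsbig_seq ?index_enum_uniq// sum_fine// => a _.
exact: fin_num_measure.
Qed.

Lemma mcyl_rcons (mu : probability X R) (w : seq A) :
  mcyl mu w = \sum_(b : A) mcyl mu (rcons w b).
Proof.
apply: measure_letter_partition => [b||x]; first exact: measurable_cyl.
  by move=> b c _ _ [x [/cyl_rcons[_ <-] /cyl_rcons[_ <-]]].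
split=> [wx|[b /cyl_rcons[]//]].
by exists (x (size w)); apply/cyl_rcons.
Qed.

Lemma measure_preimage_shift_cyl (mu : probability X R) (w : seq A) :
  fine (mu (shift @^-1` cyl w)) = \sum_(a : A) mcyl mu (a :: w).
Proof.
apply: measure_letter_partition => [b||x]; first exact: measurable_cyl.
  by move=> b c _ _ [x [/cyl_cons[<- _] /cyl_cons[<- _]]].
split=> [wx|[b /cyl_cons[]//]].
by exists (x 0%N); apply/cyl_cons.
Qed.

Lemma mcyl_nil (mu : probability X R) : mcyl mu [::] = 1.
Proof.
rewrite /mcyl; have -> : cyl [::] = setT by apply/seteqP; split.
by rewrite probability_setT.
Qed.

Lemma compatible_invariant_weight (g : X -> R) (mu : probability X R) :
  compatible g mu -> invariant_weight (mcyl mu).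
Proof.
move=> [mu0 [muT _]]; split=> [|w|w|w].
- exact: mcyl_nil.
- by rewrite /mcyl fine_gt0// mu0/= ltey_eq fin_num_measure//; exact: measurable_cyl.
- exact: mcyl_rcons.
- by rewrite -measure_preimage_shift_cyl /mcyl muT//; exact: measurable_cyl.
Qed.

Definition weight_ratio (m : seq A -> R) (w : seq A) : R := m w / m (behead w).

Section Ratio.
Variables (m : seq A -> R) (mI : invariant_weight m).

(** For [w] = [a :: v], the ratio at [w] is the average of the ratios at the words [rcons w b] with
    weights [m (rcons v b) / m v], so one of them is at most the average. *)
Lemma weight_ratio_le (w : seq A) (c : R) : w != [::] -> weight_ratio m w <= c ->
  exists b, weight_ratio m (rcons w b) <= c.
Proof.
case: w => [//|a w] _; rewrite /weight_ratio /= => wc.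
apply: contrapT => /forallNP nb.
have nb' b : c * m (rcons w b) < m (a :: rcons w b).
  by rewrite -ltr_pdivlMr ?(weight_gt0 mI)// ltNge; apply/negP/nb.
move: wc; rewrite ler_pdivrMr ?(weight_gt0 mI)// leNgt => /negP; apply.
rewrite (weight_rcons mI w) mulr_sumr (weight_rcons mI (a :: w)).
apply: ltr_sum => [|b _]; last exact: nb'.
by apply/hasP; exists a0; rewrite ?mem_index_enum.
Qed.

Lemma weight_ratio_ge (w : seq A) (c : R) : w != [::] -> c <= weight_ratio m w ->
  exists b, c <= weight_ratio m (rcons w b).
Proof.
case: w => [//|a w] _; rewrite /weight_ratio /= => wc.
apply: contrapT => /forallNP nb.
have nb' b : m (a :: rcons w b) < c * m (rcons w b).
  by rewrite -ltr_pdivrMr ?(weight_gt0 mI)// ltNge; apply/negP/nb.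
move: wc; rewrite ler_pdivlMr ?(weight_gt0 mI)// leNgt => /negP; apply.
rewrite (weight_rcons mI w) mulr_sumr (weight_rcons mI (a :: w)).
apply: ltr_sum => [|b _]; last exact: nb'.
by apply/hasP; exists a0; rewrite ?mem_index_enum.
Qed.

Variable g : X -> R.
Hypothesis mg : forall x : X,
  (fun n => weight_ratio m (prefix x n.+1)) @ \oo --> (g x : R).

(** Extending [w] letter by letter while the ratio stays below its initial value leads to a point
    where the limit of the ratios, [g x], is below it too. *)
Lemma g_le_weight_ratio (w : seq A) : w != [::] ->
  exists x : X, cyl w x /\ g x <= weight_ratio m w.
Proof.
move=> w0.
have [//||x [wx Px]] := @extend_path A a0
  (fun v => v != [::] /\ weight_ratio m v <= weight_ratio m w) w.
  move=> v [v0 /(weight_ratio_le v0)[b vb]]; exists b; split=> //.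
  by rewrite -size_eq0 size_rcons.
exists x; split=> //.
apply: (cvgr_to_le (@mg x)).
by near=> n; apply: (Px n.+1 _).2; near: n; exists (size w) => // k /leqW.
Unshelve. all: by end_near. Qed.

Lemma weight_ratio_le_g (w : seq A) : w != [::] ->
  exists x : X, cyl w x /\ weight_ratio m w <= g x.
Proof.
move=> w0.
have [//||x [wx Px]] := @extend_path A a0
  (fun v => v != [::] /\ weight_ratio m w <= weight_ratio m v) w.
  move=> v [v0 /(weight_ratio_ge v0)[b vb]]; exists b; split=> //.
  by rewrite -size_eq0 size_rcons.
exists x; split=> //.
apply: (cvgr_to_ge (@mg x)).
by near=> n; apply: (Px n.+1 _).2; near: n; exists (size w) => // k /leqW.
Unshelve. all: by end_near. Qed.

End Ratio.

Lemma compatible_weight_ratio (g : X -> R) (mu : probability X R) :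
  compatible g mu -> forall x : X,
  (fun n => weight_ratio (mcyl mu) (prefix x n.+1)) @ \oo --> (g x : R).
Proof.
move=> [_ [_ mug]] x; apply: cvg_trans (mug x); apply: near_eq_cvg.
by apply: nearW => n; rewrite /weight_ratio -prefix_shift.
Qed.

End Invariant_weights.

(** * Oscillations under the transfer operator *)

Section Transfer.
Set Implicit Arguments. Unset Strict Implicit.
Variables (A : finType) (a0 : A) (R : realType).
Local Notation X := (X a0).
Implicit Types (f : X -> R) (x y : X).

Definition agree k x y := forall i, (i < k)%N -> x i = y i.

Lemma agree_le k l x y : (k <= l)%N -> agree l x y -> agree k x y.
Proof. by move=> kl xy i ik; apply: xy; exact: leq_trans kl. Qed.

Lemma agree_cons k x y (a : A) :
  agree k x y -> agree k.+1 (cons_word a x) (cons_word a y).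
Proof. by move=> xy [|i]//= /xy. Qed.

(** Signed differences suffice because the two points can be swapped. For the unit-valued functions
    considered below the set is bounded, so that [sup] is meaningful. *)
Definition osc k f : R :=
  sup [set f p.1 - f p.2 | p in [set p : X * X | agree k p.1 p.2]].

Definition unit_valued f := forall x, 0 <= f x <= 1.

Lemma osc_ub k f x y : unit_valued f -> agree k x y -> f x - f y <= osc k f.
Proof.
move=> f01 xy; apply: ub_le_sup; last by exists (x, y).
exists 1 => _ [[u v] _ <-] /=.
by have /andP[_ fu] := f01 u; have /andP[fv _] := f01 v; lra.
Qed.

Lemma osc_le k f b : (forall x y, agree k x y -> f x - f y <= b) -> osc k f <= b.
Proof.
move=> fb; apply: ge_sup => [|_ [[x y] /= xy <-]]; last exact: fb.
by exists (f point - f point), (point, point).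
Qed.

Lemma osc_ge0 k f : unit_valued f -> 0 <= osc k f.
Proof. by move=> f01; rewrite -(subrr (f point)); exact: osc_ub. Qed.

Lemma osc_loc_const k l f : loc_const l f -> (l <= k)%N -> osc k f <= 0.
Proof.
by move=> fl lk; apply: osc_le => x y /(agree_le lk)/fl ->; rewrite subrr.
Qed.

Lemma osc_norm f x y : unit_valued f -> `|f x - f y| <= osc 0 f.
Proof.
by move=> f01; rewrite ler_norml lerNl opprB !osc_ub.
Qed.

Variable G : X -> R.
Hypothesis G0 : forall x, 0 < G x.
Hypothesis G1 : forall x, \sum_(a : A) G (cons_word a x) = 1.

Definition transfer f : X -> R :=
  fun x => \sum_(a : A) G (cons_word a x) * f (cons_word a x).

Lemma transfer_unit_valued f : unit_valued f -> unit_valued (transfer f).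
Proof.
move=> f01 x; apply/andP; split.
  apply: sumr_ge0 => a _; rewrite mulr_ge0 ?(ltW (G0 _))//.
  by case/andP: (f01 (cons_word a x)).
rewrite -(G1 x); apply: ler_sum => a _.
by rewrite ler_piMr ?(ltW (G0 _))//; case/andP: (f01 (cons_word a x)).
Qed.

Lemma transfer_loc_const l f :
  loc_const l.+1 G -> loc_const l f -> loc_const l (transfer f).
Proof.
move=> Gl fl x y xy; apply: eq_bigr => a _; congr (_ * _).
  by apply: Gl; exact: agree_cons.
by apply: fl; exact: agree_le (leqnSn l) (agree_cons a xy).
Qed.

(* Couple the two one-step transitions so that they add the same letter with
   probability at least [p]. *)
Lemma osc_transfer k f (p : R) : unit_valued f -> 0 <= p ->
  (forall x y, agree k.+1 x y -> p * G x <= G y) ->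
  osc k (transfer f) <= p * osc k.+1 f + (1 - p) * osc 0 f.
Proof.
move=> f01 p0 pG; apply: osc_le => x y xy.
(* [W a] is the mass left for the letter [a] in the chain from [y] after removing the shared part, p
   times the transition from [x]. On the shared part both points get the same letter and agree on
   [k.+1] coordinates; on the rest only [osc 0] is available. *)
pose W a := G (cons_word a y) - p * G (cons_word a x).
have W0 a : 0 <= W a by rewrite subr_ge0; apply: pG; exact: agree_cons.
have sW : \sum_a W a = 1 - p by rewrite sumrB -mulr_sumr !G1 mulr1.
have -> : transfer f x - transfer f y =
    p * \sum_a G (cons_word a x) * (f (cons_word a x) - f (cons_word a y)) +
    \sum_a W a * (transfer f x - f (cons_word a y)).
  under [X in _ = p * X + _]eq_bigr do rewrite mulrBr.
  under [X in _ = _ + X]eq_bigr do rewrite mulrBr.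
  rewrite !sumrB -mulr_suml sW -/(transfer f x).
  under [X in _ = _ + (_ - X)]eq_bigr do rewrite /W mulrBl -mulrA.
  rewrite sumrB -mulr_sumr -/(transfer f y); ring.
apply: lerD.
  rewrite ler_wpM2l// -[leRHS]mul1r -(G1 x) mulr_suml.
  apply: ler_sum => a _; rewrite ler_wpM2l ?(ltW (G0 _))// osc_ub//.
  exact: agree_cons.
rewrite -sW mulr_suml; apply: ler_sum => b _; rewrite ler_wpM2l//.
rewrite -[f (cons_word b y)]mul1r -(G1 x) mulr_suml /transfer -sumrB.
rewrite -[leRHS]mul1r -(G1 x) mulr_suml; apply: ler_sum => a _.
by rewrite -mulrBr ler_wpM2l ?(ltW (G0 _))// osc_ub.
Qed.

Variables (l : nat) (s : nat -> R).
Hypothesis Gl : loc_const l.+1 G.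
Hypothesis s0 : forall k, 0 <= s k.
Hypothesis Gs : forall k x y, agree k x y -> ln (G x) - ln (G y) <= s k.

Lemma expRN_var_le k x y : agree k x y -> expR (- s k) * G x <= G y.
Proof.
move=> xy; rewrite -[X in _ * X]lnK ?posrE// -[leRHS]lnK ?posrE// -expRD ler_expR.
by have := Gs xy; lra.
Qed.

Variables (r : nat) (f : X -> R).
Hypothesis rl : (r <= l)%N.
Hypothesis fr : loc_const r f.
Hypothesis f01 : unit_valued f.

Local Notation F j := (iter j transfer f).

Lemma iter_transfer_unit_valued j : unit_valued (F j).
Proof. by elim: j => //= j; exact: transfer_unit_valued. Qed.

Lemma iter_transfer_loc_const j : loc_const l (F j).
Proof.
elim: j => /= [|j]; last exact: transfer_loc_const.
by move=> x y /(agree_le rl)/fr.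
Qed.

Lemma osc_indicator_le k : osc k f <= (k < r)%:R.
Proof.
have [kr|rk] := ltnP k r; last exact: osc_loc_const rk.
apply: osc_le => x y _; rewrite mulr1n.
by have /andP[_ fu] := f01 x; have /andP[fv _] := f01 y; lra.
Qed.

(** The term j = 0 is at most the indicator of k < r, the others obey the coupling estimate. This
    leaves sums over n - 1 iterates, completed to n by a nonnegative term. *)
Lemma sum_osc_step n k (W := fun k => \sum_(j < n) osc k (F j))
    (p := expR (- s k.+1)) :
  W k <= (k < r)%:R + p * W k.+1 + (1 - p) * W 0%N.
Proof.
have p1 : p <= 1 by rewrite -expR0 ler_expR oppr_le0.
have p0 : 0 <= p by exact: expR_ge0.
have osc0 i j := osc_ge0 i (iter_transfer_unit_valued j).
have Fp j : osc k (F j.+1) <= p * osc k.+1 (F j) + (1 - p) * osc 0 (F j).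
  apply: osc_transfer => //; first exact: iter_transfer_unit_valued.
  by move=> x y; exact: expRN_var_le.
rewrite {}/W; case: n => [|n].
  by rewrite !big_ord0 !mulr0 !addr0.
rewrite big_ord_recl -addrA; apply: lerD; first exact: osc_indicator_le.
apply: (@le_trans _ _ (\sum_(j < n) (p * osc k.+1 (F j) + (1 - p) * osc 0 (F j)))).
  by apply: ler_sum => j _; exact: Fp.
rewrite big_split -!mulr_sumr /= !big_ord_recr/=.
by rewrite lerD// ler_wpM2l ?subr_ge0// lerDl; exact: osc0.
Qed.

(** The previous step rearranges to p (W 0 - W k.+1) <= (W 0 - W k) + [k < r]. Multiplying by the
    earlier factors, whose product is at most 1, and inducting counts the indices below [r]. *)
Lemma sum_osc_diff n k (W := fun k => \sum_(j < n) osc k (F j)) :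
  expR (- \sum_(1 <= i < k.+1) s i) * (W 0%N - W k) <= (minn k r)%:R.
Proof.
elim: k => [|k IHk]; first by rewrite subrr mulr0.
have -> : minn k.+1 r = (minn k r + (k < r))%N.
  have [kr|rk] := ltnP k r; first by rewrite (minn_idPl kr) addn1.
  by rewrite (minn_idPr (leqW rk)) addn0.
rewrite big_nat_recr//= opprD expRD natrD.
have step : W k <= (k < r)%:R + expR (- s k.+1) * W k.+1 +
    (1 - expR (- s k.+1)) * W 0%N by exact: sum_osc_step.
set S := expR (- \sum_(1 <= i < k.+1) s i) in IHk *.
set p := expR (- s k.+1) in step *.
have S0 : 0 <= S by exact: expR_ge0.
have S1 : S <= 1 by rewrite -expR0 ler_expR oppr_le0 sumr_ge0.
have pD : p * (W 0%N - W k.+1) <= (W 0%N - W k) + (k < r)%:R by lra.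
rewrite -mulrA; apply: le_trans (ler_wpM2l S0 pD) _; rewrite mulrDr lerD//.
by rewrite ler_piMl.
Qed.

(** At k = l the sum W l is nonpositive, since all iterates depend on [l] coordinates only. The
    bound is uniform in [n], which forces small oscillations along the iterates. *)
Lemma sum_osc_le n :
  \sum_(j < n) osc 0 (F j) <= r%:R * expR (\sum_(1 <= i < l.+1) s i).
Proof.
have /= := sum_osc_diff n l.
rewrite (minn_idPr rl) expRN ler_pdivrMl ?expR_gt0// mulrC.
apply: le_trans; rewrite lerDl oppr_ge0; apply: sumr_le0 => j _.
exact: osc_loc_const (iter_transfer_loc_const j) (leqnn l).
Qed.

Lemma osc_iter_small (e : R) : 0 < e -> exists n, osc 0 (F n) < e.
Proof.
move=> e0; apply: contrapT => /forallNP ne.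
pose B := r%:R * expR (\sum_(1 <= i < l.+1) s i).
have [n Bn] : exists n : nat, B / e < n%:R.
  exists (Num.bound (B / e)); apply: archi_boundP.
  by rewrite divr_ge0 ?mulr_ge0 ?expR_ge0// ltW.
have := sum_osc_le n; rewrite leNgt => /negP; apply.
apply: (@lt_le_trans _ _ (n%:R * e)); first by rewrite -ltr_pdivrMr.
rewrite mulr_natl -[in leLHS](card_ord n) -sumr_const; apply: ler_sum => j _.
by rewrite leNgt; apply/negP/ne.
Qed.

End Transfer.

(** * Sums over the words of a given length *)

Section Word_sums.
Set Implicit Arguments. Unset Strict Implicit.
Variables (A : finType) (R : realType).
Implicit Types (F H : seq A -> R) (n : nat).

(** Recursion makes prepending a letter computational, as invariance requires; [word_sumSr] gives
    the appending form that additivity requires. *)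
Fixpoint word_sum n F : R :=
  if n is n'.+1 then \sum_(a : A) word_sum n' (fun w => F (a :: w)) else F [::].

Lemma word_sumSr n F :
  word_sum n.+1 F = word_sum n (fun w => \sum_(b : A) F (rcons w b)).
Proof.
elim: n F => [//|n IHn] F; apply: eq_bigr => a _; exact: (IHn (fun w => F (a :: w))).
Qed.

Lemma ler_word_sum n F H :
  (forall w, size w = n -> F w <= H w) -> word_sum n F <= word_sum n H.
Proof.
elim: n F H => /= [F H|n IHn F H] FH; first exact: FH.
by apply: ler_sum => a _; apply: IHn => w wn; apply: FH; rewrite /= wn.
Qed.

Lemma eq_word_sum n F H :
  (forall w, size w = n -> F w = H w) -> word_sum n F = word_sum n H.
Proof.
by move=> FH; apply/le_anti; rewrite !ler_word_sum// => w /FH->.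
Qed.

Lemma word_sumZ n c F : word_sum n (fun w => c * F w) = c * word_sum n F.
Proof.
elim: n F => //= n IHn F; rewrite mulr_sumr.
by apply: eq_bigr => a _; rewrite IHn.
Qed.

Lemma word_sumB n F H :
  word_sum n (fun w => F w - H w) = word_sum n F - word_sum n H.
Proof.
by elim: n F H => //= n IHn F H; rewrite -sumrB; apply: eq_bigr => a _; rewrite IHn.
Qed.

Lemma ler_norm_word_sum n F :
  `|word_sum n F| <= word_sum n (fun w => `|F w|).
Proof.
elim: n F => //= n IHn F; apply: le_trans (ler_norm_sum _ _ _) _.
by apply: ler_sum => a _; exact: IHn.
Qed.

Lemma word_sum_exchange n (F : A -> seq A -> R) :
  word_sum n (fun w => \sum_a F a w) = \sum_a word_sum n (F a).
Proof.
elim: n F => //= n IHn F; rewrite exchange_big/=.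
by apply: eq_bigr => b _; rewrite IHn.
Qed.

Lemma word_sum_delta F u : word_sum (size u) (fun w => F w * (w == u)%:R) = F u.
Proof.
elim: u F => [|a u IHu] F /=; first by rewrite mulr1.
rewrite (bigD1 a)//= big1 ?addr0 => [|b ba].
  rewrite -[RHS](IHu (fun w => F (a :: w))); apply: eq_word_sum => w _.
  by rewrite eqseq_cons eqxx.
rewrite -[RHS](mul0r (word_sum (size u) (fun=> 0))) -word_sumZ.
by apply: eq_word_sum => w _; rewrite eqseq_cons (negbTE ba) mulr0 mul0r.
Qed.

End Word_sums.

(** * Means of functions of finitely many coordinates *)

Section Means.
Set Implicit Arguments. Unset Strict Implicit.
Variables (A : finType) (a0 : A) (R : realType).
Local Notation X := (X a0).
Local Notation cyl := (@cyl A a0).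
Local Notation prefix := (@Defs.prefix A a0).
Local Notation word_point := (@word_point A a0).
Implicit Types (f : X -> R) (m : seq A -> R).

(** Plays the role of the integral: [f] is sampled at each word continued by [a0], which is exact
    for functions of the first [n] coordinates. *)
Definition mean n m f : R := word_sum n (fun w => m w * f (word_point w)).

Lemma agree_word_point n w (v : seq A) :
  size w = n -> agree n (word_point (w ++ v)) (word_point w).
Proof. by move=> wn i iltn; rewrite /word_point nth_cat wn iltn. Qed.

Lemma word_point_cons (a : A) w : word_point (a :: w) = cons_word a (word_point w).
Proof. by apply/funext => -[]. Qed.

Section Invariant.
Variables (m : seq A -> R) (mI : invariant_weight m).

Lemma word_sum_weight n : word_sum n m = 1.
Proof.
elim: n => [|n <-]; first exact: weight_nil.
by rewrite word_sumSr; apply: eq_word_sum => w _; rewrite -weight_rcons.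
Qed.

Lemma mean_ge n f c : (forall x, c <= f x) -> c <= mean n m f.
Proof.
move=> cf; rewrite -[c]mulr1 -(word_sum_weight n) -word_sumZ.
by apply: ler_word_sum => w _; rewrite mulrC ler_wpM2l// ltW// weight_gt0.
Qed.

Lemma mean_le n f c : (forall x, f x <= c) -> mean n m f <= c.
Proof.
move=> cf; rewrite -[leRHS]mulr1 -(word_sum_weight n) -word_sumZ.
by apply: ler_word_sum => w _; rewrite [leRHS]mulrC ler_wpM2l// ltW// weight_gt0.
Qed.

Lemma meanS n f : loc_const n f -> mean n.+1 m f = mean n m f.
Proof.
move=> fn; rewrite /mean word_sumSr; apply: eq_word_sum => w wn.
rewrite (weight_rcons mI) mulr_suml; apply: eq_bigr => b _.
by rewrite (fn (word_point (rcons w b)) (word_point w))// -cats1; exact: agree_word_point.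
Qed.

Lemma mean_loc_const n l f : loc_const n f -> (n <= l)%N -> mean l m f = mean n m f.
Proof.
move=> fn; elim: l => [|l IHl]; first by rewrite leqn0 => /eqP->.
rewrite leq_eqVlt => /predU1P[->//|nl]; rewrite meanS ?IHl// => x y xy.
by apply: fn; exact: agree_le xy.
Qed.

Lemma mean_indicator l (u : seq A) : (size u <= l)%N ->
  mean l m (fun x => (prefix x (size u) == u)%:R) = m u.
Proof.
move=> ul; rewrite (mean_loc_const _ ul) => [|x y xy]; last first.
  by rewrite (eq_prefix xy).
rewrite -[RHS]word_sum_delta; apply: eq_word_sum => w wu.
by rewrite -wu (cylP _ _).1.
Qed.

(** For fixed [w] the errors m (a :: w) - m w G sum to zero over [a], by invariance of [m] and
    normalization of [G]. A constant may therefore be subtracted from [f], and only its oscillation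
    enters. *)
Lemma mean_transfer l G f c : unit_valued f -> loc_const l f ->
  (forall x, \sum_(a : A) G (cons_word a x) = 1) -> (forall x, 0 < G x) ->
  (forall a w, size w = l ->
    `|m (a :: w) - m w * G (word_point (a :: w))| <=
      c * (m w * G (word_point (a :: w)))) ->
  `|mean l m f - mean l m (transfer G f)| <= c * osc 0 f.
Proof.
move=> f01 fl G1 G0 mG; rewrite -meanS// /mean /= -word_sum_exchange -word_sumB.
apply: le_trans (ler_norm_word_sum _ _) _.
rewrite -[leRHS]mulr1 -(word_sum_weight l) -word_sumZ; apply: ler_word_sum => w wl.
have -> : \sum_a m (a :: w) * f (word_point (a :: w)) -
    m w * transfer G f (word_point w) =
  \sum_a (m (a :: w) - m w * G (word_point (a :: w))) *
    (f (word_point (a :: w)) - f point).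
  under [RHS]eq_bigr do rewrite mulrBr.
  rewrite sumrB -mulr_suml sumrB -(weight_cons mI) -mulr_sumr.
  under [X in m w - m w * X]eq_bigr do rewrite word_point_cons.
  rewrite G1 mulr1 subrr mul0r subr0 /transfer mulr_sumr -sumrB.
  by apply: eq_bigr => a _; rewrite mulrBl word_point_cons mulrA.
apply: le_trans (ler_norm_sum _ _ _) _.
rewrite -[leRHS]mulr1 -(G1 (word_point w)) mulr_sumr; apply: ler_sum => a _.
rewrite normrM -mulrA mulrAC -word_point_cons; apply: ler_pM => //.
- exact: mG.
- exact: osc_norm.
Qed.

End Invariant.

Lemma mean_diff n m m' f : invariant_weight m -> invariant_weight m' ->
  unit_valued f -> mean n m f - mean n m' f <= osc 0 f.
Proof.
move=> mI mI' f01; rewrite lerBlDl -lerBlDr; apply: mean_ge => // y.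
by rewrite lerBlDr; apply: mean_le => // x; rewrite -lerBlDl osc_ub.
Qed.

(** Telescoping along the iterates of the transfer operator: the mean under [m'] does not change,
    each step costs [m] at most c times an oscillation, and an almost constant iterate has almost
    equal means. *)
Lemma weight_comparison (m m' : seq A -> R) (G : X -> R) (l : nat)
    (s : nat -> R) (c : R) (u : seq A) :
  invariant_weight m -> invariant_weight m' ->
  (forall x, 0 < G x) -> (forall x, \sum_(a : A) G (cons_word a x) = 1) ->
  loc_const l.+1 G -> (forall k, 0 <= s k) ->
  (forall k x y, agree k x y -> ln (G x) - ln (G y) <= s k) ->
  (forall a w, size w = l -> m' (a :: w) = m' w * G (word_point (a :: w))) ->
  (forall a w, size w = l ->
    `|m (a :: w) - m w * G (word_point (a :: w))| <=
      c * (m w * G (word_point (a :: w)))) ->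
  0 <= c -> (size u <= l)%N ->
  `|m u - m' u| <= c * ((size u)%:R * expR (\sum_(1 <= i < l.+1) s i)).
Proof.
move=> mI mI' G0 G1 Gl s0 Gs m'G mG c0 ul.
pose f x : R := (prefix x (size u) == u)%:R.
have fu : loc_const (size u) f.
  by move=> x y xy; rewrite /f (eq_prefix xy).
have f01 : unit_valued f.
  by move=> x; rewrite /f; case: (_ == _); rewrite ?lexx ler01.
have Fl := iter_transfer_loc_const Gl ul fu.
have F01 := iter_transfer_unit_valued G0 G1 f01.
(* To be used for [m] with d = c and for [m'] with d = 0. *)
have tele (m1 : seq A -> R) (d : R) (n : nat) : invariant_weight m1 ->
    (forall a w, size w = l ->
      `|m1 (a :: w) - m1 w * G (word_point (a :: w))| <=
      d * (m1 w * G (word_point (a :: w)))) ->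
    `|m1 u - mean l m1 (iter n (transfer G) f)| <=
      d * \sum_(j < n) osc 0 (iter j (transfer G) f).
  move=> m1I m1G; elim: n => [|n IHn].
    by rewrite /= mean_indicator// subrr normr0 big_ord0 mulr0.
  rewrite big_ord_recr mulrDr.
  apply: le_trans (lerD IHn (mean_transfer m1I (F01 n) (Fl n) G1 G0 m1G)).
  by apply: le_trans (ler_normD _ _); rewrite addrA subrK.
apply/ler_addgt0Pr => e e0.
have [n ne] := osc_iter_small G0 G1 Gl s0 Gs ul fu f01 e0.
have h1 := tele m c n mI mG.
have h2 : `|m' u - mean l m' (iter n (transfer G) f)| <= 0.
  rewrite -[leRHS](mul0r (\sum_(j < n) osc 0 (iter j (transfer G) f))).
  by apply: tele => // a w wl; rewrite (m'G a w wl) subrr normr0 mul0r.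
have h3 := mean_diff l mI mI' (F01 n).
have h4 := mean_diff l mI' mI (F01 n).
have h5 := sum_osc_le G0 G1 Gl s0 Gs ul fu f01 n.
have h6 := ler_wpM2l c0 h5.
move: h1 h2; rewrite !ler_norml => /andP[h1 h1'] /andP[h2 h2'].
by apply/andP; split; lra.
Qed.

End Means.

(** * Measures with given cylinder weights, by coding the unit interval *)

Section Uniform.
Variable R : realType.

Lemma uniform_prob_itvco (a b : R) : 0 <= a -> a < b -> b <= 1 ->
  uniform_prob (@ltr01 R) `[a, b[%classic = (b - a)%:E.
Proof.
move=> a0 ab b1; rewrite /uniform_prob.
rewrite (eq_integral (fun=> 1%E)) => [|t].
  by rewrite integral_cst//= mul1e lebesgue_measure_itv/= lte_fin ab.
rewrite inE/= in_itv/= => /andP[at_ tb].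
by rewrite /uniform_pdf subr0 invr1 (le_trans a0 at_) (le_trans (ltW tb) b1).
Qed.

End Uniform.

Section Measure_of_weight.
Set Implicit Arguments. Unset Strict Implicit.
Variables (A : finType) (a0 : A) (R : realType).
Local Notation X := (X a0).
Local Notation cyl := (@cyl A a0).
Local Notation prefix := (@Defs.prefix A a0).
Variables (m : seq A -> R) (mI : invariant_weight m).

Let m0 w : 0 < m w := weight_gt0 mI w.

Definition weight_below (w : seq A) (b : A) : R :=
  \sum_(c : A | (enum_rank c < enum_rank b)%N) m (rcons w c).

(** The total weight of the words of the same length that precede [w] lexicographically, letters
    being ordered by [enum_rank]. *)
Definition left_end (w : seq A) : R :=
  \sum_(i < size w) weight_below (take i w) (nth a0 w i).

(* [word_itv w] is the interval of length [m w] that codes the cylinder of [w]: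
   the intervals of the [rcons w b] subdivide that of [w]. *)
Definition word_itv (w : seq A) (t : R) : bool :=
  left_end w <= t < left_end w + m w.

Lemma left_end_rcons w b : left_end (rcons w b) = left_end w + weight_below w b.
Proof.
rewrite /left_end size_rcons big_ord_recr /= nth_rcons ltnn eqxx.
congr (_ + _); last by rewrite -cats1 take_size_cat.
apply: eq_bigr => i _; rewrite nth_rcons ltn_ord -cats1 takel_cat//.
exact: ltnW.
Qed.

Lemma word_itv_nil t : word_itv [::] t = (0 <= t < 1).
Proof. by rewrite /word_itv /left_end big_ord0 (weight_nil mI) add0r. Qed.

Lemma weight_below_ge0 w b : 0 <= weight_below w b.
Proof. by apply: sumr_ge0 => c _; exact/ltW. Qed.

Lemma weight_below_lt w b c : (enum_rank b < enum_rank c)%N ->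
  weight_below w b + m (rcons w b) <= weight_below w c.
Proof.
move=> bc; rewrite addrC {2}/weight_below (bigD1 b)//= lerD2l /weight_below.
rewrite big_mkcond [leRHS]big_mkcond; apply: ler_sum => d _.
case: ifPn => [db|_]; last by case: ifP => // _; exact/ltW.
by rewrite (ltn_trans db bc)/=; case: eqP db => [->|//]; rewrite ltnn.
Qed.

Lemma weight_below_le w b : weight_below w b + m (rcons w b) <= m w.
Proof.
rewrite addrC (weight_rcons mI w) [leRHS](bigD1 b)//= lerD2l /weight_below.
rewrite big_mkcond [leRHS]big_mkcond; apply: ler_sum => d _.
case: ifPn => [db|_]; last by case: ifP => // _; exact/ltW.
by case: eqP db => [->|//]; rewrite ltnn.
Qed.

Lemma word_itv_sub w b t : word_itv (rcons w b) t -> word_itv w t.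
Proof.
rewrite /word_itv left_end_rcons => /andP[wt tw].
have := weight_below_ge0 w b; have := weight_below_le w b.
by move=> h1 h2; apply/andP; split; lra.
Qed.

Lemma word_itv_rcons_inj w b c t :
  word_itv (rcons w b) t -> word_itv (rcons w c) t -> b = c.
Proof.
rewrite /word_itv !left_end_rcons => /andP[h1 h2] /andP[h3 h4].
apply/enum_rank_inj/val_inj/eqP.
by case: ltngtP => //= /(weight_below_lt w) h; lra.
Qed.

Lemma word_itv_inj v w t :
  size v = size w -> word_itv v t -> word_itv w t -> v = w.
Proof.
elim/last_ind: v w => [|v b IHv] w; first by case: w.
case/lastP: w => [|w c]; first by rewrite size_rcons.
rewrite !size_rcons => -[vw] vt wt.
have E : v = w by apply: IHv => //; [exact: word_itv_sub vt|exact: word_itv_sub wt].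
by rewrite -E in wt *; rewrite (word_itv_rcons_inj vt wt).
Qed.

Lemma word_itv_split w t : word_itv w t -> exists b, word_itv (rcons w b) t.
Proof.
move=> /andP[wt tw].
pose F i := \sum_(c : A | (enum_rank c < i)%N) m (rcons w c).
have Fex : exists i, t < left_end w + F i.
  exists #|A|; rewrite /F (eq_bigl xpredT) -?(weight_rcons mI)// => c.
  by rewrite ltn_ord.
(* If [i.+1] is the least index whose partial sum passes [t], the letter of rank [i] is the one
   sought. *)
case: (ex_minnP Fex) => -[|i] ti mini.
  by move: ti; rewrite /F big_pred0// addr0 ltNge wt.
have ti' : left_end w + F i <= t.
  by rewrite leNgt; apply/negP => /mini; rewrite ltnn.
have [iA|Ai] := ltnP i #|A|.
  pose b := enum_val (Ordinal iA).
  have rb : enum_rank b = i :> nat by rewrite enum_valK.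
  exists b; rewrite /word_itv left_end_rcons /weight_below rb ti'/=.
  rewrite -addrA -/(F i); suff <- : F i.+1 = F i + m (rcons w b) by [].
  rewrite /F (bigD1 b)/= ?rb// addrC; congr (_ + _); apply: eq_bigl => c.
  rewrite ltnS [RHS]ltn_neqAle andbC -rb; congr (_ && _).
  by rewrite -(inj_eq enum_rank_inj).
have FE : F i.+1 = F i.
  apply: eq_bigl => c; rewrite ltnS (leq_trans (ltn_ord _) Ai).
  by rewrite (leq_trans (ltnW (ltn_ord _)) Ai).
by move: ti; rewrite FE ltNge ti'.
Qed.

(** The default [point] makes the coding map total, and constant off the unit interval. *)
Lemma itinerary_exists t : exists x : X,
  if 0 <= t < 1 then forall n, word_itv (prefix x n) t else x = point.
Proof.
have [|_] := boolP (0 <= t < 1); last by exists point.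
rewrite -word_itv_nil => t01.
have [//||x [_ xt]] := @extend_path A a0 (fun w => word_itv w t) [::].
  by move=> v; exact: word_itv_split.
by exists x => n; exact: xt.
Qed.

Definition itinerary (t : R) : X := sval (cid (itinerary_exists t)).

Lemma itineraryP t : if 0 <= t < 1
  then forall n, word_itv (prefix (itinerary t) n) t else itinerary t = point.
Proof. exact: svalP (cid (itinerary_exists t)). Qed.

Lemma itinerary_cyl w : itinerary @^-1` cyl w `&` `[0, 1[ =
  `[left_end w, left_end w + m w[%classic.
Proof.
have wsub v b : word_itv (rcons v b) `<=` word_itv v by move=> t; exact: word_itv_sub.
have w01 v t : word_itv v t -> 0 <= t < 1.
  rewrite -word_itv_nil; elim/last_ind: v => // v b IHv /word_itv_sub.
  exact: IHv.
apply/seteqP; split=> t /=; rewrite ?in_itv/=.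
- move=> [wt t01]; have := itineraryP t.
  by rewrite t01 => /(_ (size w)); rewrite ((cylP _ _).1 wt).
- move=> wt; have t01 := w01 _ _ wt; split=> //.
  have := itineraryP t; rewrite t01 => /(_ (size w)) tw.
  by apply/cylP; apply: (word_itv_inj _ tw wt); rewrite size_mkseq.
Qed.

Lemma measurable_itinerary : measurable_fun [set: measurableTypeR R] itinerary.
Proof.
have mX : @measurable _ X = <<s @cylinders A a0 >> by [].
apply: (measurability _ mX) => _ [_ [w _ <-] <-].
rewrite setTI; set D : set (measurableTypeR R) := `[0, 1[%classic.
have mD : measurable D by exact: measurable_itv.
(* Inside [D] the preimage is an interval; outside, the map is constant and the preimage is
   everything or empty. *)
rewrite -[X in measurable X]setIT -(setUv D) setIUr itinerary_cyl.
apply: measurableU; first exact: measurable_itv.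
have [wp|wp] := pselect (cyl w (point : X)).
  suff -> : itinerary @^-1` cyl w `&` ~` D = ~` D by exact: measurableC.
  apply/seteqP; split=> [t []//|t tD]; split=> //=.
  have := itineraryP t.
  by move: tD; rewrite /D /= in_itv/= => /negP/negbTE -> ->.
suff -> : itinerary @^-1` cyl w `&` ~` D = set0 by exact: measurable0.
apply/seteqP; split=> [t [/= wt tD]|//]; apply: wp.
have := itineraryP t.
by move: tD; rewrite /D /= in_itv/= => /negP/negbTE -> <-.
Qed.

Lemma left_end_ge0 w : 0 <= left_end w.
Proof. by apply: sumr_ge0 => i _; exact: weight_below_ge0. Qed.

Lemma left_end_le1 w : left_end w + m w <= 1.
Proof.
elim/last_ind: w => [|w b IHw].
  by rewrite /left_end big_ord0 (weight_nil mI) add0r.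
rewrite left_end_rcons -addrA; apply: le_trans IHw.
by rewrite lerD2l weight_below_le.
Qed.

(** The law of the itinerary of a uniform random number: the cylinder of [w] corresponds to an
    interval of length [m w], up to a null set. *)
Lemma measure_of_weight :
  exists mu : probability X R, forall w, mcyl mu w = m w.
Proof.
pose P : probability (measurableTypeR R) R := uniform_prob (@ltr01 R).
pose phi : {mfun measurableTypeR R >-> X} := HB.pack itinerary
  (isMeasurableFun.Build _ _ (measurableTypeR R) X itinerary measurable_itinerary).
exists (distribution P phi) => w; rewrite /mcyl /distribution /pushforward /=.
have mw : measurable (itinerary @^-1` cyl w).
  rewrite -[X in measurable X]setTI; apply: measurable_itinerary => //.
  exact: measurable_cyl.
have P01 : P `[0, 1[%classic = 1%E.
  by rewrite /P /= uniform_prob_itvco ?subr0 ?ltr01.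
have -> : P (itinerary @^-1` cyl w) = (m w)%:E; last by [].
rewrite (measureDI P mw (measurable_itv `[0, 1[)) itinerary_cyl.
rewrite [X in (X + _)%E](_ : _ = 0%E).
  rewrite add0e /P /= uniform_prob_itvco ?left_end_ge0 ?left_end_le1 ?ltrDl ?m0//.
  by rewrite addrAC subrr add0r.
apply/eqP; rewrite eq_le measure_ge0 andbT.
apply: (@le_trans _ _ (P (~` `[0, 1[%classic))).
  apply: le_measure; rewrite ?inE; [exact: measurableD|exact: measurableC|].
  by move=> t [].
by rewrite probability_setC// P01 subee.
Qed.

End Measure_of_weight.

(** * Uniform continuity and comparison of g-measures *)

Section Regularity.
Set Implicit Arguments. Unset Strict Implicit.
Variables (A : finType) (a0 : A) (R : realType).
Local Notation X := (X a0).
Local Notation cyl := (@cyl A a0).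
Local Notation prefix := (@Defs.prefix A a0).
Implicit Types (f g h : X -> R) (x y : X).

Lemma cyl_agree w x y : cyl w x -> cyl w y -> agree (size w) x y.
Proof. by move=> wx wy i iw; rewrite wx ?wy. Qed.

Lemma agree_prefix n x : agree n x (word_point a0 (prefix x n)).
Proof. by move=> i ilt; rewrite /word_point nth_mkseq. Qed.

(** Compactness through König's lemma: if uniformity fails, there is a path each of whose prefixes
    starts arbitrarily close pairs with values at least [e] apart, against continuity at the limit
    point. *)
Lemma prod_continuous_uniform f : prod_continuous f ->
  forall e : R, 0 < e -> exists n, forall x y, agree n x y -> `|f x - f y| < e.
Proof.
move=> fc e e0; apply: contrapT => /forallNP bad.
pose P w := forall n, exists x y, [/\ cyl w x, agree n x y & e <= `|f x - f y|].
have P0 : P [::].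
  move=> n; have /existsNP[x /existsNP[y /not_implyP[xy /negP]]] := bad n.
  by rewrite -leNgt => fxy; exists x, y; split.
have Pext w : P w -> exists b, P (rcons w b).
  move=> Pw; apply: contrapT => /forallNP nb.
  have /boolp.choice[N NP] : forall b, exists n, forall x y,
      cyl (rcons w b) x -> agree n x y -> `|f x - f y| < e.
    move=> b; have /existsNP[n nP] := nb b; exists n => x y wx xy.
    by rewrite ltNge; apply/negP => fxy; apply: nP; exists x, y; split.
  (* The sum dominates every [N b], hence serves whichever letter follows [w] in [x]. *)
  have [x [y [wx xy]]] := Pw (\sum_b N b)%N.
  rewrite leNgt => /negP; apply; apply: (NP (x (size w))).
    exact/cyl_rcons.
  by apply: agree_le xy; rewrite (bigD1 (x (size w)))//= leq_addr.
have [z [_ zP]] := extend_path a0 P0 Pext.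
have e2 : 0 < e / 2 by rewrite divr_gt0.
have [n nP] := fc z _ e2.
have [x [y [zx xy]]] := zP n (leq0n _) n; rewrite leNgt => /negP; apply.
have xz : agree n x z.
  by move=> i ilt; rewrite zx ?size_mkseq// nth_mkseq.
have fx := nP x xz.
have fy : `|f y - f z| < e / 2 by apply: nP => i ilt; rewrite -xy// xz.
rewrite -(subrK (f z) (f x)) -addrA; apply: le_lt_trans (ler_normD _ _) _.
by rewrite (splitr e) ltrD// distrC.
Qed.

Lemma word_sum_ge n (F : seq A -> R) w :
  size w = n -> (forall v, 0 <= F v) -> F w <= word_sum n F.
Proof.
move=> <- F0; rewrite -[leLHS]word_sum_delta; apply: ler_word_sum => v _.
by case: (_ == _); rewrite ?mulr1 ?mulr0.
Qed.

Lemma prod_continuous_bounded f : prod_continuous f ->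
  exists B, forall x, `|f x| <= B.
Proof.
move=> fc; have [n nP] := prod_continuous_uniform fc ltr01.
exists (1 + word_sum n (fun w => `|f (word_point a0 w)|)) => x.
rewrite -(subrK (f (word_point a0 (prefix x n))) (f x)).
apply: le_trans (ler_normD _ _) _; apply: lerD.
  exact/ltW/nP/agree_prefix.
exact: (@word_sum_ge n (fun w => `|f (word_point a0 w)|) _ (size_mkseq _ _)).
Qed.

Lemma gfunction_gt0 g : gfunction g -> forall x, 0 < g x.
Proof. by move=> [_ [g01 _]] x; case/andP: (g01 x). Qed.

(** In [gfunction] the first letter of the point is overwritten, so [a0] can be put in front of
    [x]. *)
Lemma gfunction_sum g : gfunction g -> forall x, \sum_a g (cons_word a x) = 1.
Proof. by move=> [_ [_ g1]] x; rewrite -[RHS](g1 (cons_word a0 x)). Qed.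

Lemma gfunction_ln_continuous g : gfunction g -> prod_continuous (fun x => ln (g x)).
Proof.
move=> gg x e e0; have gx := gfunction_gt0 gg x.
have /cvgrPdist_lt/(_ _ e0)/nbhs_ballP[d /= d0 dP] := continuous_ln gx.
have [n nP] := gg.1 x d d0; exists n => y xy; rewrite distrC; apply: dP.
by rewrite /ball /= distrC; exact: nP.
Qed.

Lemma supnorm_ub f B : (forall x, `|f x| <= B) -> forall x, `|f x| <= supnorm f.
Proof.
move=> fB x; apply: ub_le_sup; last by exists x.
by exists B => _ [y _ <-].
Qed.

Lemma var_ge0 k f : 0 <= var k f.
Proof. exact: bigmax_ge_id. Qed.

Lemma var_ub k f B x y : (forall z, `|f z| <= B) -> agree k x y ->
  f x - f y <= var k f.
Proof.
move=> fB xy.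
pose F (w : k.-tuple A) := sup (f @` cyl (val w)) - inf (f @` cyl (val w)).
have sk : size (prefix x k) == k by rewrite size_mkseq.
apply: (@le_trans _ _ (F (Tuple sk))); last exact: (le_bigmax 0 F).
have xx : cyl (prefix x k) x by exact: cyl_prefix.
have xy' : cyl (prefix x k) y by rewrite (eq_prefix xy); exact: cyl_prefix.
apply: lerB.
  apply: ub_le_sup; last by exists x.
  by exists B => _ [z _ <-]; exact: le_trans (ler_norm _) (fB z).
apply: ge_inf; last by exists y.
by exists (- B) => _ [z _ <-]; have := fB z; rewrite ler_norml => /andP[].
Qed.

Lemma svar_ge0 k f : 0 <= svar k f.
Proof. by apply: sumr_ge0 => i _; exact: var_ge0. Qed.

Lemma supnorm_ln_div g h : gfunction g -> gfunction h ->
  forall x, `|ln (g x) - ln (h x)| <= supnorm (fun x => ln (g x / h x)).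
Proof.
move=> gg gh x.
have [B gB] := prod_continuous_bounded (gfunction_ln_continuous gg).
have [C hC] := prod_continuous_bounded (gfunction_ln_continuous gh).
rewrite -ln_div ?posrE ?gfunction_gt0//.
apply: (@supnorm_ub (fun x => ln (g x / h x)) (B + C)) => y.
rewrite ln_div ?posrE ?gfunction_gt0//.
by apply: le_trans (ler_normB _ _) _; exact: lerD.
Qed.

(** The ratio lies between the values of [h] at two points of the cylinder; there log h is within d
    of log g, which is within e of its value at [x]. *)
Lemma ln_weight_ratio_close (m : seq A -> R) h g (d e : R) w x :
  invariant_weight m ->
  (forall y, (fun n => weight_ratio m (prefix y n.+1)) @ \oo --> (h y : R)) ->
  (forall y, 0 < h y) ->
  (forall y, `|ln (h y) - ln (g y)| <= d) ->
  (forall y, agree (size w) y x -> `|ln (g y) - ln (g x)| <= e) ->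
  w != [::] -> cyl w x ->
  `|ln (weight_ratio m w) - ln (g x)| <= d + e.
Proof.
move=> mI mh h0 hg ge w0 wx.
have r0 : 0 < weight_ratio m w by rewrite divr_gt0// weight_gt0.
have [y [wy hy]] := g_le_weight_ratio mI mh w0.
have [z [wz hz]] := weight_ratio_le_g mI mh w0.
have := ge y (cyl_agree wy wx); have := ge z (cyl_agree wz wx).
have := hg y; have := hg z.
have hy' : ln (h y) <= ln (weight_ratio m w) by rewrite ler_ln ?posrE.
have hz' : ln (weight_ratio m w) <= ln (h z) by rewrite ler_ln ?posrE.
by rewrite !ler_norml => /andP[? ?] /andP[? ?] /andP[? ?] /andP[? ?]; lra.
Qed.

(** From 1 - d <= e^(-d) follows e^d <= 1 / (1 - d), and this is at most 1 + 2 d when d <= 1/2. *)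
Lemma expRB1_le (d : R) : 0 <= d <= 1/2 -> expR d - 1 <= 2 * d.
Proof.
move=> /andP[d0 d1]; have h1 := expR_ge1Dx (- d).
have h2 : expR (- d) * expR d = 1 by rewrite -expRD addNr expR0.
have h3 := expR_gt0 d.
by nra.
Qed.

(** On words of length l + 1 the ratios of [mu] equal [g], which is constant on such cylinders, and
    those of [nu] are within a factor e^d of it; hence [weight_comparison] applies with c = e^d -
    1. *)
Lemma compatible_comparison g h (mu nu : probability X R) l (d : R) u :
  gfunction g -> gfunction h -> compatible g mu -> compatible h nu ->
  loc_const l.+1 g -> (forall x, `|ln (h x) - ln (g x)| <= d) -> 0 <= d <= 1/2 ->
  (size u <= l)%N ->
  `|mcyl nu u - mcyl mu u| <=
    2 * d * ((size u)%:R * expR (svar l (fun x => ln (g x)))).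
Proof.
move=> gg gh gmu hnu gl hg d01 ul.
have muI := compatible_invariant_weight gmu.
have nuI := compatible_invariant_weight hnu.
have [B gB] := prod_continuous_bounded (gfunction_ln_continuous gg).
have g0 := gfunction_gt0 gg.
have /andP[d0 _] := d01.
have e1 : 0 <= expR d - 1 by rewrite subr_ge0 -expR0 ler_expR.
have close (m : seq A -> R) f (c : R) a w : invariant_weight m ->
    (forall y, (fun n => weight_ratio m (prefix y n.+1)) @ \oo --> (f y : R)) ->
    (forall y, 0 < f y) -> (forall x, `|ln (f x) - ln (g x)| <= c) ->
    size w = l ->
    `|ln (weight_ratio m (a :: w)) - ln (g (word_point a0 (a :: w)))| <= c.
  move=> mI mf f0 fg wl; rewrite -[leRHS]addr0.
  apply: (ln_weight_ratio_close mI mf f0 fg) => // y yx.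
  rewrite (gl y (word_point a0 (a :: w))) ?subrr ?normr0// => i.
  by rewrite -wl; exact: yx.
apply: (@le_trans _ _ ((expR d - 1) *
    ((size u)%:R * expR (svar l (fun x => ln (g x)))))); last first.
  by rewrite ler_wpM2r ?expRB1_le// mulr_ge0// expR_ge0.
apply: (weight_comparison nuI muI g0 (gfunction_sum gg) gl) => //.
- by move=> k; exact: var_ge0.
- by move=> k x y; exact: var_ub gB.
- move=> a w wl.
  have g0' : forall x, `|ln (g x) - ln (g x)| <= 0.
    by move=> x; rewrite subrr normr0.
  have := close _ _ 0 a w muI (compatible_weight_ratio gmu) g0 g0' wl.
  rewrite normr_le0 subr_eq0 => /eqP/ln_inj E.
  rewrite -E ?posrE ?divr_gt0 ?(weight_gt0 muI)//.
  by rewrite mulrC divfK// gt_eqF// (weight_gt0 muI).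
- move=> a w wl.
  have := close _ _ d a w nuI (compatible_weight_ratio hnu) (gfunction_gt0 gh) hg wl.
  have nw := weight_gt0 nuI w; have naw := weight_gt0 nuI (a :: w).
  set p := g (word_point a0 (a :: w)); have p0 : 0 < p := g0 _.
  rewrite /weight_ratio ln_div ?posrE//= => lnr.
  have -> : mcyl nu (a :: w) = mcyl nu w * expR (ln (mcyl nu (a :: w)) - ln (mcyl nu w)).
    by rewrite expRB !lnK ?posrE// mulrC divfK ?gt_eqF.
  set t := ln (mcyl nu (a :: w)) - ln (mcyl nu w) in lnr *.
  rewrite -mulrBr normrM gtr0_norm// mulrCA ler_pM2l//.
  have -> : expR t = expR (t - ln p) * p by rewrite expRB lnK ?posrE// divfK ?gt_eqF.
  rewrite -[X in _ - X]mul1r -mulrBl normrM (gtr0_norm p0) ler_pM2r//.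
  move: lnr; rewrite ler_norml => /andP[lo hi].
  have h1 : expR (t - ln p) <= expR d by rewrite ler_expR.
  have h2 : expR (- d) <= expR (t - ln p) by rewrite ler_expR.
  (* The deviation from below is covered as well: 1 - e^(-d) <= d <= e^d - 1. *)
  have h3 := expR_ge1Dx d; have h4 := expR_ge1Dx (- d).
  by rewrite ler_norml; apply/andP; split; lra.
Qed.

End Regularity.

(** * Determination of measures by their cylinder values *)

Section Cylinder_determination.
Set Implicit Arguments. Unset Strict Implicit.
Variables (A : finType) (a0 : A) (R : realType).
Local Notation X := (X a0).
Local Notation cyl := (@cyl A a0).
Local Notation shift := (@Defs.shift A a0).

(** Two cylinders are nested or disjoint; adding the empty set for the second case gives a
    pi-system. *)
Lemma cylI_closed : setI_closed (@cylinders A a0 `|` [set set0]).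
Proof.
have wlogE (v w : seq A) : (size v <= size w)%N ->
    (@cylinders A a0 `|` [set set0]) (cyl v `&` cyl w).
  move=> vw; have [[x [vx wx]]|/forallNP nx] := pselect (exists x, (cyl v `&` cyl w) x).
    left; exists w => //; apply/seteqP; split=> [y wy|y []//]; split=> // i iv.
    have iw := leq_trans iv vw.
    by rewrite wy// -vx// wx.
  by right; apply/seteqP; split=> [y /nx|].
move=> _ _ [[v _ <-]|->] [[w _ <-]|->]; rewrite ?setI0 ?set0I; try by right.
by have [vw|/ltnW vw] := leqP (size v) (size w); [|rewrite setIC]; exact: wlogE.
Qed.

Lemma mcylK (mu : probability X R) w : (mcyl mu w)%:E = mu (cyl w).
Proof. by rewrite fineK// fin_num_measure//; exact: measurable_cyl. Qed.

Lemma probability_cyl_unique (mu nu : probability X R) :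
  (forall w, mcyl mu w = mcyl nu w) -> forall E, measurable E -> mu E = nu E.
Proof.
move=> munu E; apply: (@measure_unique _ R X
  (@cylinders A a0 `|` [set set0]) (fun=> setT) _ _ _ _ mu nu).
- apply/seteqP; split.
    by apply: sub_smallest2r => //; exact: subsetUl.
  apply: smallest_sub; first exact: sigma_algebra_measurable.
  by move=> _ [[w _ <-]|->]; [exact: measurable_cyl|exact: measurable0].
- exact: cylI_closed.
- by move=> _; left; exists [::] => //; apply/seteqP; split.
- by rewrite bigcup_const//; exists 0%N.
- move=> _ [[w _ <-]|->]; last by rewrite !measure0.
  by have := congr1 EFin (munu w); rewrite !mcylK.
- by move=> _; apply: (le_lt_trans (probability_le1 mu measurableT)); exact: ltry.
Qed.

Lemma measurable_shift : measurable_fun setT shift.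
Proof.
have mX : @measurable _ X = <<s @cylinders A a0 >> by [].
apply: (measurability _ mX) => _ [_ [w _ <-] <-]; rewrite setTI.
have -> : shift @^-1` cyl w = \bigcup_(a in [set: A]) cyl (a :: w).
  apply/seteqP; split=> x /=; first by move=> wx; exists (x 0%N) => //; apply/cyl_cons.
  by move=> [a _ /cyl_cons[]].
apply: fin_bigcup_measurable; first exact: finite_finset.
by move=> a _; exact: measurable_cyl.
Qed.

(** Invariance means that the image of [mu] under the shift is [mu], which can be tested on
    cylinders. *)
Lemma cyl_shift_invariant (mu : probability X R) :
  (forall w, mcyl mu w = \sum_(a : A) mcyl mu (a :: w)) ->
  forall E, measurable E -> mu (shift @^-1` E) = mu E.
Proof.
move=> muT; pose sh : {mfun X >-> X} := HB.pack shift
  (isMeasurableFun.Build _ _ X X shift measurable_shift).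
apply: (@probability_cyl_unique (distribution mu sh) mu) => w.
by rewrite muT -measure_preimage_shift_cyl.
Qed.

End Cylinder_determination.

(** * The limit of the approximating measures *)

Section Limit.
Set Implicit Arguments. Unset Strict Implicit.
Variables (A : finType) (a0 : A) (R : realType).
Local Notation X := (X a0).
Local Notation cyl := (@cyl A a0).
Local Notation prefix := (@Defs.prefix A a0).
Variables (gs : nat -> X -> R) (g : X -> R) (mus : nat -> probability X R).
Hypothesis gsg : forall l, gfunction (gs l).
Hypothesis gsl : forall l, loc_const l.+1 (gs l).
Hypothesis gsmu : forall l, compatible (gs l) (mus l).
Hypothesis gg : gfunction g.

Let D l := supnorm (fun x => ln (g x / gs l x)).
Let S l := expR (svar l (fun x => ln (gs l x))).

Hypothesis DS0 : (fun l : nat => D l * S l : R) @ \oo --> (0 : R).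

Let Dclose l x : `|ln (g x) - ln (gs l x)| <= D l.
Proof. exact: supnorm_ln_div. Qed.

Let D_ge0 l : 0 <= D l.
Proof. exact: le_trans (normr_ge0 _) (Dclose l point). Qed.

Let S_ge1 l : 1 <= S l.
Proof. by rewrite -expR0 ler_expR svar_ge0. Qed.

Let D0 : D l @[l --> \oo] --> (0 : R).
Proof.
apply: (@squeeze_cvgr _ _ _ _ (fun=> 0) (fun l => D l * S l)) => //.
  by apply: nearW => l; rewrite D_ge0 ler_peMr.
exact: cvg_cst.
Qed.

Let D_small (e : R) : 0 < e -> \forall l \near \oo, D l <= e.
Proof. by move=> e0; apply: cvgr_le D0 _ e0. Qed.

(** The comparison with d = D l bounds the difference by 2 |u| D l S l. As the sequence does not
    depend on [nu], this also gives uniqueness. *)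
Lemma compatible_cvg (nu : probability X R) u : compatible g nu ->
  mcyl (mus l) u @[l --> \oo] --> mcyl nu u.
Proof.
move=> gnu; apply/cvgrPdist_le => e e0.
pose K : R := 2 * (size u)%:R + 1.
have K0 : 0 < K by rewrite ltr_wpDl ?mulr_ge0.
have eK : 0 < e / K by rewrite divr_gt0.
near=> l.
apply: le_trans (compatible_comparison (gsg l) gg (gsmu l) gnu
  (@gsl l) (@Dclose l) _ _) _.
- by rewrite D_ge0; near: l; apply: D_small; rewrite divr_gt0.
- by near: l; exists (size u).
have DS : D l * S l <= e / K by near: l; apply: cvgr_le DS0 _ eK.
rewrite -/(S l); rewrite ler_pdivlMr// in DS; apply: le_trans DS; rewrite /K.
have DS_ge0 : 0 <= D l * S l by rewrite mulr_ge0// (le_trans ler01).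
by have : 0 <= (size u)%:R :> R by []; nra.
Unshelve. all: by end_near. Qed.

(** Cauchy criterion: log (gs k) is within D l + D k of log (gs l), and the exponential factor is
    that of the fixed index [l]. First [l] is chosen with D l S l small, then [k] so large that D k
    S l is small. *)
Lemma mcyl_is_cvg u : cvg (mcyl (mus l) u @[l --> \oo]).
Proof.
apply: cauchy_cvg; apply: cauchy_exP => e e0.
(* With this [K], 2 |u| D l S l and 2 |u| D k S l are each at most e / 2; the 1 keeps [K] positive
   for empty [u]. *)
pose K : R := 4 * (size u)%:R + 1.
have K0 : 0 < K by rewrite ltr_wpDl ?mulr_ge0.
have eK : 0 < e / K by rewrite divr_gt0.
have : \forall l \near \oo, [/\ (size u <= l)%N, D l <= 1/4 & D l * S l < e / K].
  near=> l; split.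
  - by near: l; exists (size u).
  - by near: l; apply: D_small; rewrite divr_gt0.
  - by near: l; apply: cvgr_lt DS0 _ eK.
move=> [l _ /(_ l (leqnn l))[ul Dl DSl]].
have S0 : 0 < S l by rewrite (lt_le_trans ltr01).
exists (mcyl (mus l) u).
suff : \forall k \near \oo, ball (mcyl (mus l) u) e (mcyl (mus k) u) by [].
near=> k.
have Dk1 : D k <= 1/4 by near: k; apply: D_small; rewrite divr_gt0.
have Dk2 : D k <= e / K / S l by near: k; apply: D_small; rewrite !divr_gt0.
have close x : `|ln (gs k x) - ln (gs l x)| <= D l + D k.
  have := Dclose l x; have := Dclose k x.
  by rewrite !ler_norml => /andP[? ?] /andP[? ?]; apply/andP; split; lra.
have Dlk : 0 <= D l + D k <= 1/2.
  by rewrite addr_ge0//=; lra.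
have := compatible_comparison (gsg l) (gsg k) (gsmu l) (gsmu k) (@gsl l) close Dlk ul.
rewrite /ball /= distrC -/(S l) => /le_lt_trans; apply.
rewrite ler_pdivlMr// in Dk2.
rewrite ltr_pdivlMr// in DSl.
have K1 : D k * S l * K <= e by rewrite -ler_pdivlMr.
have DSl0 : 0 <= D l * S l by rewrite mulr_ge0// ltW.
have DSk0 : 0 <= D k * S l by rewrite mulr_ge0// ltW.
have n0 : 0 <= (size u)%:R :> R by [].
rewrite /K in DSl K1.
by nra.
Unshelve. all: by end_near. Qed.

Let m u : R := lim (mcyl (mus l) u @[l --> \oo]).

Let m_cvg u : mcyl (mus l) u @[l --> \oo] --> m u.
Proof. exact: mcyl_is_cvg. Qed.

Let musI l : invariant_weight (mcyl (mus l)) := compatible_invariant_weight (gsmu l).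

Let ratio_close (w : seq A) (x : X) (e : R) l :
  (forall y, agree (size w) y x -> `|ln (g y) - ln (g x)| <= e) ->
  w != [::] -> cyl w x ->
  `|ln (weight_ratio (mcyl (mus l)) w) - ln (g x)| <= D l + e.
Proof.
apply: (ln_weight_ratio_close (musI l) (compatible_weight_ratio (gsmu l))).
  exact: gfunction_gt0.
by move=> y; rewrite distrC.
Qed.

(** Positivity survives the limit because the ratios are eventually bounded below: with |log g| <= B
    and D l <= 1, the logarithm of a ratio is at least - B - 1 - 2 B. *)
Let m_gt0 w : 0 < m w.
Proof.
have [B gB] := prod_continuous_bounded (gfunction_ln_continuous gg).
elim: w => [|a w IHw].
  suff -> : m [::] = 1 by [].
  apply: cvg_lim => //; under eq_fun do rewrite mcyl_nil; exact: cvg_cst.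
have c0 := expR_gt0 (- (1 + 3 * B)).
apply: (@lt_le_trans _ _ (expR (- (1 + 3 * B)) * m w)); first by rewrite mulr_gt0.
have h : expR (- (1 + 3 * B)) * mcyl (mus l) w @[l --> \oo] -->
    expR (- (1 + 3 * B)) * m w by apply: cvgM => //; exact: cvg_cst.
apply: (ler_cvg_to h (@m_cvg (a :: w))).
near=> l.
have mw := weight_gt0 (musI l) w; have maw := weight_gt0 (musI l) (a :: w).
rewrite -ler_pdivlMr//.
pose x : X := word_point a0 (a :: w).
have ge y : `|ln (g y) - ln (g x)| <= 2 * B.
  have := gB y; have := gB x; rewrite !ler_norml => /andP[? ?] /andP[? ?].
  by apply/andP; split; lra.
have := @ratio_close (a :: w) x _ l (fun y _ => ge y) isT (fun i _ => erefl).
have D1 : D l <= 1 by near: l; apply: D_small.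
have r0 : 0 < weight_ratio (mcyl (mus l)) (a :: w) by rewrite divr_gt0.
have := gB x; rewrite !ler_norml => /andP[? ?] /andP[? ?].
apply: (@le_trans _ _ (expR (ln (weight_ratio (mcyl (mus l)) (a :: w))))).
  by rewrite ler_expR; lra.
by rewrite lnK ?posrE.
Unshelve. all: by end_near. Qed.

Let mI : invariant_weight m.
Proof.
split=> [|//|w|w].
- apply: cvg_lim => //; under eq_fun do rewrite mcyl_nil; exact: cvg_cst.
- apply: cvg_lim => //; under eq_fun do rewrite mcyl_rcons.
  by apply: cvg_big => [|b _]; [exact: add_continuous|exact: m_cvg].
- apply: cvg_lim => //; under eq_fun do rewrite (weight_cons (musI _)).
  by apply: cvg_big => [|b _]; [exact: add_continuous|exact: m_cvg].
Qed.

(** For a fixed prefix, letting [l] tend to infinity turns the bound D l + e into e; uniform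
    continuity of log g provides any e for long prefixes. *)
Let m_ratio (x : X) :
  (fun n => weight_ratio m (prefix x n.+1)) @ \oo --> (g x : R).
Proof.
have r0 w : 0 < weight_ratio m w by rewrite divr_gt0.
suff : (fun n => ln (weight_ratio m (prefix x n.+1))) @ \oo --> (ln (g x) : R).
  move=> /(continuous_cvg _ (@continuous_expR R (ln (g x)))).
  rewrite lnK ?posrE ?gfunction_gt0//; apply: cvg_trans; apply: near_eq_cvg.
  by apply: nearW => n; rewrite /= lnK ?posrE.
apply/cvgrPdist_le => e e0.
have [N NP] := prod_continuous_uniform (gfunction_ln_continuous gg) e0.
near=> n; set w := prefix x n.+1.
have Nn : (N <= n.+1)%N by apply: leqW; near: n; exists N.
have lnr : ln (weight_ratio (mcyl (mus l)) w) @[l --> \oo] --> ln (weight_ratio m w).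
  apply: (continuous_cvg _ (continuous_ln (r0 w))).
  by apply: cvgM; [exact: m_cvg|apply: cvgV; [rewrite gt_eqF|exact: m_cvg]].
have h : D l + e @[l --> \oo] --> 0 + e by apply: cvgD => //; exact: cvg_cst.
rewrite add0r in h.
have h' : `|ln (g x) - ln (weight_ratio (mcyl (mus l)) w)| @[l --> \oo] -->
    `|ln (g x) - ln (weight_ratio m w)|.
  by apply: cvg_norm; apply: cvgB => //; exact: cvg_cst.
apply: (ler_cvg_to h' h); apply: nearW => l; rewrite distrC.
apply: ratio_close; last exact: cyl_prefix.
  by move=> y; rewrite size_mkseq => yx; apply/ltW/NP/(agree_le Nn).
by rewrite -size_eq0 size_mkseq.
Unshelve. all: by end_near. Qed.

Lemma compatible_limit_exists : exists mu : probability X R, compatible g mu.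
Proof.
have [mu muE] := measure_of_weight a0 mI.
exists mu; split=> [w|]; first by rewrite -mcylK lte_fin muE.
split=> [|x].
  by apply: cyl_shift_invariant => w; rewrite muE (weight_cons mI); apply: eq_bigr.
apply: cvg_trans (@m_ratio x); apply: near_eq_cvg; apply: nearW => n.
by rewrite /weight_ratio !muE -prefix_shift.
Qed.

(** First letters are removed until the word is short. Each removal costs at most e, so a word of
    length n has a log-difference of at most n e, which the factor 1/n compensates. *)
Lemma compatible_rho_cvg (mu : probability X R) :
  compatible g mu -> rho (mus l) mu @[l --> \oo] --> 0%E.
Proof.
move=> gmu; have muI := compatible_invariant_weight gmu.
have rho_ge0 l : (0 <= rho (mus l) mu)%E.
  apply: (@le_trans _ _ ((1%:R)^-1 * `|ln (mcyl (mus l) [:: a0] / mcyl mu [:: a0])|)%:E).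
    by rewrite lee_fin mulr_ge0.
  by apply: ereal_sup_ubound; exists [:: a0].
suff rho_le (e : R) : 0 < e -> \forall l \near \oo, (rho (mus l) mu <= e%:E)%E.
  apply/fine_cvgP; split.
    apply: filterS (rho_le 1 ltr01) => l le1.
    by rewrite ge0_fin_numE// (le_lt_trans le1)// ltry.
  apply/cvgrPdist_le => e e0; apply: filterS (rho_le e e0) => l lee.
  have rfin : rho (mus l) mu \is a fin_num.
    by rewrite ge0_fin_numE// (le_lt_trans lee)// ltry.
  rewrite sub0r normrN ger0_norm/= ?fine_ge0//.
  by rewrite -lee_fin fineK.
move=> e0; have e4 : 0 < e / 4 by rewrite divr_gt0.
have [N NP] := prod_continuous_uniform (gfunction_ln_continuous gg) e4.
have ln_cvg w : ln (mcyl (mus l) w) @[l --> \oo] --> ln (mcyl mu w).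
  apply: (continuous_cvg _ (continuous_ln (weight_gt0 muI w))).
  exact: compatible_cvg.
(* There are finitely many words of length at most N + 1, so convergence is uniform over them. *)
have near_short : \forall l \near \oo, forall w : {bseq N.+1 of A},
    `|ln (mcyl mu w) - ln (mcyl (mus l) w)| <= e.
  by apply: filter_forall => w; move/cvgrPdist_le : (ln_cvg (val w)) => /(_ e e0).
have e2 : 0 < e / 2 by rewrite divr_gt0.
near=> l.
have De : D l <= e / 2 by near: l; exact: D_small.
have short : forall w : {bseq N.+1 of A},
    `|ln (mcyl mu w) - ln (mcyl (mus l) w)| <= e by near: l.
have main w : w != [::] ->
    `|ln (mcyl (mus l) w) - ln (mcyl mu w)| <= (size w)%:R * e.
  elim: w => // a v IHv _; have [vN|Nv] := leqP (size (a :: v)) N.+1.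
    rewrite distrC; apply: le_trans (short (Bseq vN)) _.
    by rewrite ler_peMl ?(ltW e0)// ler1n.
  have v0 : v != [::] by case: (v) Nv.
  have {}IHv := IHv v0.
  pose x : X := word_point a0 (a :: v).
  have gx y : agree (size (a :: v)) y x -> `|ln (g y) - ln (g x)| <= e / 4.
    by move=> yx; apply/ltW/NP/(agree_le _ yx)/ltnW/ltnW.
  (* The first letter costs D l + e / 4 for [mus l] and e / 4 for [mu], in total at most e. *)
  have h1 := @ratio_close (a :: v) x (e / 4) l gx isT (fun i _ => erefl).
  have h2 : `|ln (weight_ratio (mcyl mu) (a :: v)) - ln (g x)| <= 0 + e / 4.
    apply: (ln_weight_ratio_close muI (compatible_weight_ratio gmu)) => //.
    - exact: gfunction_gt0.
    - by move=> y; rewrite subrr normr0.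
  have lnE (mu' : probability X R) : invariant_weight (mcyl mu') ->
      ln (weight_ratio (mcyl mu') (a :: v)) = ln (mcyl mu' (a :: v)) - ln (mcyl mu' v).
    by move=> I; rewrite /weight_ratio ln_div ?posrE ?(weight_gt0 I).
  move: h1 h2 IHv; rewrite !lnE// !ler_norml /= -[(size v).+1]addn1 natrD mulrDl mul1r.
  by move=> /andP[? ?] /andP[? ?] /andP[? ?]; apply/andP; split; lra.
apply: ge_ereal_sup => _ [w /= w0 <-]; rewrite lee_fin.
rewrite ler_pdivrMl ?ltr0n// ln_div ?posrE ?weight_gt0//.
by apply: main; rewrite -size_eq0 -lt0n.
Unshelve. all: by end_near. Qed.

End Limit.

(** * Convergence in the projective distance and uniqueness of the limit *)

Theorem theorem3p4 (A : finType) (a0 : A) (R : realType)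
  (gs : nat -> X a0 -> R) (g : X a0 -> R)
  (mus : nat -> probability (X a0) R) :
  (forall l, gfunction (gs l)) ->
  (forall l, loc_const l.+1 (gs l)) ->
  (forall l, compatible (gs l) (mus l)) ->
  gfunction g ->
  (fun l : nat => supnorm (fun x => gs l x - g x) : R) @ \oo --> (0 : R) ->
  (fun l : nat => supnorm (fun x => ln (g x / gs l x))
                  * expR (svar l (fun x => ln (gs l x))) : R) @ \oo --> (0 : R) ->
  exists mu : probability (X a0) R,
    ((fun l : nat => rho (mus l) mu) @ \oo --> 0%E) /\
    compatible g mu /\
    (forall nu : probability (X a0) R, compatible g nu ->
       forall E : set (X a0), measurable E -> nu E = mu E).
Proof.
move=> gsg gsl gsmu gg _ DS0.
have [mu gmu] := compatible_limit_exists gsg gsl gsmu gg DS0.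
exists mu; split; first exact: (compatible_rho_cvg gsg gsl gsmu gg DS0).
split=> // nu gnu; apply: probability_cyl_unique => w.
(* On each cylinder [nu] and [mu] are limits of one and the same sequence. *)
apply: (cvg_unique _ (compatible_cvg gsg gsl gsmu gg DS0 (nu := nu) _)) => //.
exact: (compatible_cvg gsg gsl gsmu gg DS0).
Qed.
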